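(* Let $A,B\in\mathbb{R}^{2\times2}$ with $\det(B)=0$, and let $C=\det(A+B)-\det(A)-\det(B)$. Assume that $C$, $\operatorname{Tr}(B)$ and $\det(B)$ do not vanish simultaneously. Then the delay-differential equation $\dot x(t)=Ax(t)+Bx(t-\tau)$ is of universality class I if and only if $$|\det(A)|<|C|.$$
   Context: Generating polynomial: $p_\omega(Y)=\det[i\omega I-A-BY]$. Asymptotic continuous spectrum (ACS): the collection of curves $\left\{\frac1\tau\gamma_j(\omega)+i\omega\right\}$, $\omega\in\mathbb{R}$, $j=1,\dots,m$, where $\gamma_j(\omega)=-\ln|Y_j(\omega)|$ and $Y_j(\omega)$ are the roots of the generating polynomial, $p_\omega(Y_j(\omega))=0$. Points $\omega$ for which the polynomial is degenerate, i.e. $p_\omega(Y)\equiv\det[i\omega I-A]$ for all $Y$, are excluded. A branch of the ACS is one of the functions $\gamma_j$. Universality class I: the ACS (and the DDE) is of universality class I if there exist $\omega_H>0$ and $j\in\mathbb{N}$ such that one branch of the ACS satisfies $\gamma_j(\pm\omega_H)=0$, $\gamma_j(\omega)>0$ for all $\omega\in(-\omega_H,\omega_H)$, and $\gamma_j(\omega)<0$ for all $\omega\notin[-\omega_H,\omega_H]$; also $\gamma_k(\omega)\neq0$ for all $k\neq j$ and $\omega\in\mathbb{R}$. *)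

(* Defs.v *)
From HB Require Import structures.
From mathcomp Require Export all_boot all_order all_algebra.
From mathcomp Require Export complex.
From mathcomp Require Export all_classical all_reals all_analysis.

Set Implicit Arguments.
Unset Strict Implicit.
Unset Printing Implicit Defensive.

Import Order.TTheory GRing.Theory Num.Theory.
Import numFieldNormedType.Exports.

Local Open Scope classical_set_scope.
Local Open Scope ring_scope.
Local Open Scope complex_scope.

(** The equation x'(t) = A x(t) + B x(t - tau). *)
Record dde (R : realType) (n : nat) := DDE {
  instantaneous : 'M[R]_n ;
  delayed : 'M[R]_n ;
  delay : R
}.

Section AsymptoticContinuousSpectrum.
Context {R : realType} {n : nat}.
Implicit Types (E : dde R n) (w : R).

(** i w I - A, over the complex numbers. *)
Definition instantaneous_pencil E w : 'M[R[i]]_n :=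
  ('i%C * w%:C)%:M - map_mx (real_complex R) (instantaneous E).

(** p_w(Y) = det (i w I - A - B Y), the indeterminate Y being 'X. *)
Definition generating_poly E w : {poly R[i]} :=
  \det (map_mx polyC (instantaneous_pencil E w)
        - 'X *: map_mx polyC (map_mx (real_complex R) (delayed E))).

Definition degenerate E w : Prop :=
  forall y : R[i],
    (generating_poly E w).[y] = \det (instantaneous_pencil E w).

(** - ln |y| with values in the extended reals: a root y = 0 gives +oo, since
    [lne 0 = -oo]. *)
Definition neg_ln_abs (y : R[i]) : \bar R := (- lne (Normc.normc y)%:E)%E.

(** [D j] is the set of frequencies at which the j-th root Y_j is defined; the
    value [Y j w] is meaningless for w outside [D j]. No root is defined at a
    degenerate frequency. At any other frequency, the defined roots are all the
    roots of p_w, counted with multiplicity; there are fewer than m of them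
    where the degree of p_w drops below its maximum m (the missing roots have
    gone to infinity). *)
Definition acs_branches E (m : nat) (D : 'I_m -> set R)
    (Y : 'I_m -> R -> R[i]) : Prop :=
  [/\ forall w, degenerate E w -> forall j, ~ D j w,
      forall w, ~ degenerate E w ->
        generating_poly E w =
        lead_coef (generating_poly E w)
          *: \prod_(j < m | `[< D j w >]) ('X - (Y j w)%:P),
      exists w, forall j, D j w
    & forall j, {within D j, continuous (fun w => neg_ln_abs (Y j w))}].

(** The curves gamma_j(w) / tau + i w of the spectrum depend on the delay tau
    only through the scaling 1 / tau; the functions gamma_j, and hence the
    universality class, do not depend on it. A condition imposed on gamma_j(w)
    for all w in a set includes that gamma_j(w) is defined there. *)
Definition universality_class_I E : Prop :=
  exists (m : nat) (D : 'I_m -> set R) (Y : 'I_m -> R -> R[i]),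
    let gamma j w := neg_ln_abs (Y j w) in
    acs_branches E D Y /\
    exists (wH : R) (j : 'I_m),
      [/\ 0 < wH,
          (D j wH /\ gamma j wH = 0%E) /\
            (D j (- wH) /\ gamma j (- wH) = 0%E),
          forall w, - wH < w < wH -> D j w /\ (0 < gamma j w)%E,
          forall w, ~ (- wH <= w <= wH) -> D j w /\ (gamma j w < 0)%E
        & forall k, k != j -> forall w, D k w -> gamma k w <> 0%E].

End AsymptoticContinuousSpectrum.

(* Main.v *)
(** If det B = 0 then p_w(Y) = a(w) + b(w) Y with a(w) = det A - w^2 - i w tr A
    and b(w) = C - i w tr B, so the only root satisfies |Y(w)| = |a(w)| / |b(w)|.
    At w = 0 the condition gamma > 0 reads |det A| < |C|. Conversely,
    |a|^2 - |b|^2 is a monic quadratic in u = w^2 with constant term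
    (det A)^2 - C^2; when this is negative the quadratic has exactly one
    positive root, which is w_H^2. *)
Require Import Defs.
From mathcomp Require Import ring lra.
Import Order.TTheory GRing.Theory Num.Theory.
Import numFieldNormedType.Exports.
Local Open Scope classical_set_scope.
Local Open Scope ring_scope.
Local Open Scope complex_scope.

Lemma det_mx22 (K : comNzRingType) (M : 'M[K]_2) :
  \det M = M 0 0 * M 1 1 - M 0 1 * M 1 0.
Proof.
rewrite (expand_det_row _ 0) !big_ord_recl big_ord0 addr0 /cofactor !det_mx11.
rewrite !mxE /= expr0 expr1 mul1r mulN1r mulrN.
by congr (M _ _ * M _ _ - M _ _ * M _ _); apply/val_inj.
Qed.

Lemma mxtrace_mx22 (K : comNzRingType) (M : 'M[K]_2) : \tr M = M 0 0 + M 1 1.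
Proof.
rewrite /mxtrace !big_ord_recl big_ord0 addr0.
by congr (M _ _ + M _ _); apply/val_inj.
Qed.

(** On 2x2 matrices [\det] is a quadratic form, so the coefficient of ['X] is its polar form at [M]
    and [- N]; here [\det (- N) = \det N]. *)
Lemma det_linear_pencil (K : comNzRingType) (M N : 'M[K]_2) :
  \det (map_mx polyC M - 'X *: map_mx polyC N) =
  (\det M)%:P + (\det (M - N) - \det M - \det N) *: 'X + (\det N) *: 'X^2.
Proof.
rewrite !det_mx22 !mxE -!mul_polyC !(polyCB, polyCM, polyCD, polyCN).
ring.
Qed.

Section Pencil.
Variable R : realType.

Lemma det_instantaneous_pencil (A B : 'M[R]_2) (tau w : R) :
  \det (instantaneous_pencil (DDE A B tau) w) =
  (\det A - w ^+ 2) +i* (- (w * \tr A)).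
Proof.
rewrite /instantaneous_pencil !det_mx22 mxtrace_mx22 !mxE /=.
by apply/eqP; rewrite eq_complex /=; apply/andP; split; apply/eqP; ring.
Qed.

Lemma generating_poly_mx22 (A B : 'M[R]_2) (tau w : R) :
  generating_poly (DDE A B tau) w =
  ((\det A - w ^+ 2) +i* (- (w * \tr A)))%:P
  + ((\det (A + B) - \det A - \det B) +i* (- (w * \tr B))) *: 'X
  + (\det B)%:C *: 'X^2.
Proof.
rewrite /generating_poly det_linear_pencil det_instantaneous_pencil.
(* Subtracting [B] from the pencil of [A] gives the pencil of [A + B], so one formula covers both
   determinants; in their difference the [w ^+ 2] terms cancel. *)
rewrite (_ : instantaneous_pencil _ w - _ =
  instantaneous_pencil (DDE (A + B) B tau) w); last first.
  by rewrite /instantaneous_pencil /= map_mxD opprD addrA.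
rewrite det_instantaneous_pencil det_map_mx mxtraceD /=.
congr (_ + _ *: _ + _).
by apply/eqP; rewrite eq_complex /=; apply/andP; split; apply/eqP; ring.
Qed.

End Pencil.

Section UniversalityClassI.
Variable R : realType.

Lemma generating_poly_singular (A B : 'M[R]_2) (tau w : R) : \det B = 0 ->
  generating_poly (DDE A B tau) w =
  ((\det (A + B) - \det A - \det B) +i* (- (w * \tr B))) *: 'X
  + ((\det A - w ^+ 2) +i* (- (w * \tr A)))%:P.
Proof. by move=> B0; rewrite generating_poly_mx22 B0 scale0r addr0 addrC. Qed.

(** Continuity at 0 matters: the root [Y] vanishes wherever a(w) = 0, for instance at w = 0 when det
    A = 0, and there the branch takes the value +oo. *)
Lemma lne_EFin_continuous : continuous (fun x : R => lne x%:E).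
Proof.
move=> x; have [x0|x0] := ltP 0 x.
  apply: (@cvg_trans _ ((ln y)%:E @[y --> x])).
    apply: near_eq_cvg; near=> y; rewrite lne_EFin//.
    by near: y; exact: lt_nbhsr.
  rewrite lne_EFin//. apply: (@cvg_EFin _ _ (nbhs x) _ (EFin \o @ln R)).
    exact: nearW.
  exact: continuous_ln.
rewrite /continuous_at (le0_lneNy (x := x%:E)) ?lee_fin//; apply/cvgeNyPle => M.
near=> y; have [y0|y0] := leP y 0; first by rewrite le0_lneNy ?lee_fin ?leNye.
rewrite lne_EFin// lee_fin -[M]expRK ler_ln ?posrE ?expR_gt0//.
by near: y; apply: lt_le_nbhsl; rewrite (le_lt_trans x0) ?expR_gt0.
Unshelve. all: by end_near. Qed.

Lemma neg_ln_abs_gt0 (y : R[i]) :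
  (0 < neg_ln_abs y)%E = (Normc.normc y < 1).
Proof. by rewrite oppe_gt0 lne_lt0 lte_fin. Qed.

Lemma neg_ln_abs_lt0 (y : R[i]) :
  (neg_ln_abs y < 0)%E = (1 < Normc.normc y).
Proof. by rewrite oppe_lt0 lne_gt0 lte_fin. Qed.

Lemma neg_ln_abs_eq0 (y : R[i]) : Normc.normc y = 1 -> neg_ln_abs y = 0%E.
Proof. by rewrite /neg_ln_abs => ->; rewrite lne1 oppe0. Qed.

(** A defined branch rules out degeneracy at [w], so the factorisation applies, and its [j]-th
    factor vanishes at [Y j w]. *)
Lemma acs_branch_root {E : dde R 2} {m : nat} {D : 'I_m -> set R}
    {Y : 'I_m -> R -> R[i]} {j : 'I_m} {w : R} :
  acs_branches E D Y -> D j w -> root (generating_poly E w) (Y j w).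
Proof.
move=> [Ddeg Dprod _ _] Djw; rewrite Dprod; last by move=> /Ddeg /(_ j).
by rewrite rootE hornerZ horner_prod (bigD1 j) ?asboolT //= hornerXsubC
  subrr mul0r mulr0.
Qed.

Lemma class_I_normr_det_lt (A B : 'M[R]_2) (tau : R) : \det B = 0 ->
  universality_class_I (DDE A B tau) ->
  `|\det A| < `|\det (A + B) - \det A - \det B|.
Proof.
move=> B0 [m [D [Y [acs [wH [j [wH0 _ pos _ _]]]]]]].
have [|D0] := pos 0; first by rewrite oppr_lt0 wH0.
rewrite neg_ln_abs_gt0 => Y_lt1.
have /rootP := acs_branch_root acs D0.
rewrite generating_poly_singular// !hornerE oppr0 expr0n subr0.
set c := _ - \det B => /eqP; rewrite addr_eq0 => /eqP /(congr1 (@Normc.normc R)).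
rewrite Normc.normcM /= expr0n oppr0 expr0n !addr0 sqrrN !sqrtr_sqr => cY.
(* Strictness needs C nonzero: otherwise p_0 would be constant, making the frequency 0 degenerate
   and leaving no branch defined there. *)
have c0 : c != 0.
  have [Ddeg _ _ _] := acs.
  apply/eqP => c0; apply: (Ddeg 0 _ j D0) => y.
  rewrite generating_poly_singular// -/c c0 det_instantaneous_pencil.
  by rewrite !hornerE oppr0 -[0 +i* 0]/(0 : R[i]) mul0r add0r.
by rewrite -cY -[ltRHS]mulr1 ltr_pM2l// normr_gt0.
Qed.

(** The product [c] of the two roots is negative, so the roots are real and of opposite signs. The
    positive one is written [h ^+ 2] because u stands for w^2. *)
Lemma monic_quadratic_factor (p c : R) : c < 0 ->
  exists h k : R, [/\ 0 < h, 0 < k &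
    forall u, u ^+ 2 + p * u + c = (u - h ^+ 2) * (u + k)].
Proof.
move=> c0; pose s := Num.sqrt (p ^+ 2 - 4 * c).
have s2 : s ^+ 2 = p ^+ 2 - 4 * c by rewrite sqr_sqrtr//; nra.
have ps : `|p| < s by rewrite -sqrtr_sqr ltr_sqrt; nra.
have /andP[Nps sp] : - s < p < s by rewrite -ltr_norml.
exists (Num.sqrt ((s - p) / 2)), ((s + p) / 2); split.
- by rewrite sqrtr_gt0; lra.
- by lra.
- by move=> u; rewrite sqr_sqrtr; [nra|lra].
Qed.

Lemma class_I_of_normr_det_lt (A B : 'M[R]_2) (tau : R) : \det B = 0 ->
  `|\det A| < `|\det (A + B) - \det A - \det B| ->
  universality_class_I (DDE A B tau).
Proof.
move=> B0; have := fun w => generating_poly_singular A B tau w B0.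
set c := _ - \det B; set d := \det A; set t := \tr A; set s := \tr B => pE dc.
pose a (w : R) := (d - w ^+ 2) +i* (- (w * t)); pose b (w : R) := c +i* (- (w * s)).
(* [N] and [M] are the squared moduli of [a] and [b]. *)
pose N (w : R) := (d - w ^+ 2) ^+ 2 + (w * t) ^+ 2.
pose M (w : R) := c ^+ 2 + (w * s) ^+ 2.
have c0 : c != 0 by rewrite -normr_gt0 (le_lt_trans _ dc).
have dc2 : d ^+ 2 < c ^+ 2.
  by rewrite -[d ^+ 2]real_normK ?num_real// -[c ^+ 2]real_normK ?num_real//
    ltr_pXn2r ?nnegrE.
have M0 w : 0 < M w by rewrite ltr_wpDr ?sqr_ge0// exprn_even_gt0.
have N0 w : 0 <= N w by rewrite addr_ge0 ?sqr_ge0.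
have b0 w : b w != 0 by rewrite eq_complex /= negb_and c0.
pose Y (w : R) := - a w / b w.
have normY w : Normc.normc (Y w) = Num.sqrt (N w / M w).
  by rewrite Normc.normcM Normc.normcV sqrtrM// sqrtrV ?ltW//= !sqrrN.
have N_cont : continuous N.
  rewrite (_ : N = horner ((d%:P - 'X^2) ^+ 2 + ('X * t%:P) ^+ 2)).
    exact: continuous_horner.
  by apply/funext => w; rewrite !hornerE.
have M_cont : continuous M.
  rewrite (_ : M = horner ((c ^+ 2)%:P + ('X * s%:P) ^+ 2)).
    exact: continuous_horner.
  by apply/funext => w; rewrite !hornerE.
(* Since [w ^+ 2 + k] is positive, comparing |Y(w)| with 1 reduces to comparing |w| with [h]. *)
have [h [k [h0 k0 hkE]]] : exists h k, [/\ 0 < h, 0 < k &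
    forall w, N w - M w = (w ^+ 2 - h ^+ 2) * (w ^+ 2 + k)].
  have [|h [k [h0 k0 hk]]] := @monic_quadratic_factor
    (t ^+ 2 - s ^+ 2 - 2 * d) (d ^+ 2 - c ^+ 2); first by rewrite subr_lt0.
  by exists h, k; split => // w; rewrite -hk /N /M; ring.
have wk (w : R) : 0 < w ^+ 2 + k by rewrite ltr_wpDl ?sqr_ge0.
have Y1 (w : R) : w ^+ 2 = h ^+ 2 -> Normc.normc (Y w) = 1.
  move=> wh; have /eqP := hkE w; rewrite wh subrr mul0r subr_eq0 => /eqP NM.
  by rewrite normY NM divff ?gt_eqF// sqrtr1.
have root_quot w : generating_poly (DDE A B tau) w = b w *: ('X - (Y w)%:P).
  by rewrite pE -!mul_polyC mulrBr -polyCM /Y mulrCA divff// mulr1 polyCN opprK.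
have ndeg w : ~ degenerate (DDE A B tau) w.
  (* Degeneracy would equate the value at Y = 1 with the constant term, but they differ by [b w]. *)
  move=> /(_ 1); rewrite pE det_instantaneous_pencil !hornerE -[X in _ = X]add0r.
  by move/addIr/eqP; rewrite (negbTE (b0 w)).
(* As [b] never vanishes, p_w has degree one at every frequency: there is a single branch, defined
   on the whole line. *)
exists 1%N, (fun=> setT), (fun=> Y); split; first split.
- by move=> w /ndeg.
- move=> w _; rewrite root_quot lead_coefZ lead_coefXsubC mulr1.
  by rewrite big_mkcond big_ord_recl big_ord0 asboolT //= mulr1.
- by exists 0.
- move=> _; have -> : (fun w => neg_ln_abs (Y w)) =
    oppe \o ((fun x : R => lne x%:E) \o (Num.sqrt \o (N * (fun w => (M w)^-1)))).
    by apply/funext => w; rewrite /neg_ln_abs normY.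
  apply: continuous_subspaceT => w.
  apply: continuous_comp; last exact: oppe_continuous.
  apply: continuous_comp; last exact: lne_EFin_continuous.
  apply: continuous_comp; last exact: sqrt_continuous.
  apply: continuousM; first exact: N_cont.
  by apply: continuousV; [rewrite gt_eqF|exact: M_cont].
exists h, 0; split => //.
- by split; split => //; apply: neg_ln_abs_eq0; rewrite Y1 ?sqrrN.
- move=> w; rewrite -ltr_norml => wh; split => //.
  rewrite neg_ln_abs_gt0 normY -sqrtr1 ltr_sqrt// ltr_pdivrMr// mul1r.
  rewrite -subr_lt0 hkE pmulr_llt0// subr_lt0 -[w ^+ 2]real_normK ?num_real//.
  by rewrite ltr_pXn2r// nnegrE ltW.
- move=> w /negP; rewrite -ler_norml -ltNge => hw; split => //.
  (* This also gives [0 < N w], which the strict comparison of square roots requires. *)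
  have MN : M w < N w.
    rewrite -subr_gt0 hkE pmulr_lgt0// subr_gt0 -[w ^+ 2]real_normK ?num_real//.
    by rewrite ltr_pXn2r// nnegrE ltW.
  rewrite neg_ln_abs_lt0 normY -sqrtr1 ltr_sqrt ?divr_gt0 ?(lt_trans _ MN)//.
  by rewrite ltr_pdivlMr// mul1r.
- by move=> i; rewrite !ord1 eqxx.
Qed.

End UniversalityClassI.

Theorem lemma4p1 (R : realType) (A B : 'M[R]_2) (tau C : R)
    (tau_gt0 : 0 < tau)
    (detB0 : \det B = 0)
    (defC : C = \det (A + B) - \det A - \det B)
    (nondeg : ~ (C = 0 /\ \tr B = 0 /\ \det B = 0)) :
  universality_class_I (DDE A B tau) <-> `|\det A| < `|C|.
Proof.
rewrite defC; split; first exact: class_I_normr_det_lt.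
exact: class_I_of_normr_det_lt.
Qed.
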